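(* Let $n\ge1$ and let $\mathcal{G}$ be an abelian subgroup of $GA(n,\mathbb{C})$ generated by $p$ elements, with $p\le n$. Then $\mathcal{G}$ has no dense orbit in $\mathbb{C}^n$.
   Context: $GA(n,\mathbb{C})$ is the group (under composition) of invertible affine maps $x\mapsto Ax+a$ of $\mathbb{C}^n$, with $A\in GL(n,\mathbb{C})$, $a\in\mathbb{C}^n$. The orbit of $v\in\mathbb{C}^n$ is $\mathcal{G}(v)=\{f(v):f\in\mathcal{G}\}$. *)

(* Defs.v *)
From HB Require Import structures.
From mathcomp Require Import all_boot all_order all_algebra.
From mathcomp Require Import all_classical all_reals all_analysis.
From mathcomp Require Import complex.
Set Implicit Arguments.
Unset Strict Implicit.
Unset Printing Implicit Defensive.
Import Order.TTheory GRing.Theory Num.Theory.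
Import numFieldNormedType.Exports.
Local Open Scope classical_set_scope.
Local Open Scope ring_scope.
Local Open Scope complex_scope.

(* R[i] gets the topology of the modulus, through its regular module R[i]^o;
   'cV[R[i]]_n then carries the library's product topology. *)
#[non_forgetful_inheritance]
HB.instance Definition _ (R : realType) := NormedModule.copy R[i] (R[i]^o).

Definition affine_map (R : realType) (n : nat) (A : 'M[R[i]]_n)
    (a : 'cV[R[i]]_n) : 'cV[R[i]]_n -> 'cV[R[i]]_n :=
  fun x => A *m x + a.

Definition GA (R : realType) (n : nat) : set ('cV[R[i]]_n -> 'cV[R[i]]_n) :=
  [set f | exists (A : 'M[R[i]]_n) (a : 'cV[R[i]]_n),
      A \in unitmx /\ f = affine_map A a].

(* Elements of GA are genuine functions, so the group law is [\o]. *)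
Definition subgroup_GA (R : realType) (n : nat)
    (G : set ('cV[R[i]]_n -> 'cV[R[i]]_n)) : Prop :=
  [/\ G `<=` @GA R n,
      G id,
      (forall f g, G f -> G g -> G (f \o g)) &
      (forall f, G f -> exists g, [/\ G g, cancel f g & cancel g f])].

Definition abelian_maps (T : Type) (G : set (T -> T)) : Prop :=
  forall f g, G f -> G g -> f \o g = g \o f.

Definition gen_subgroup_GA (R : realType) (n : nat)
    (S : set ('cV[R[i]]_n -> 'cV[R[i]]_n)) :
    set ('cV[R[i]]_n -> 'cV[R[i]]_n) :=
  smallest (@subgroup_GA R n) S.

(* The p generators are given as a family, so repetitions are allowed. *)
Definition generated_by (R : realType) (n p : nat)
    (G : set ('cV[R[i]]_n -> 'cV[R[i]]_n)) : Prop :=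
  exists s : 'I_p -> ('cV[R[i]]_n -> 'cV[R[i]]_n),
    (forall i, @GA R n (s i)) /\ G = gen_subgroup_GA (range s).

Definition map_orbit (T : Type) (G : set (T -> T)) (v : T) : set T :=
  [set f v | f in G].

(* Main.v *)
(* If the orbit of v is dense, then the homogenized matrices of the elements of
   G span a commutative algebra S on which evaluation at u = (v, 1) is a linear
   isomorphism onto C^(n+1); the elements at which the affine character takes the
   value 1 correspond to C^n.  S is a product of local algebras.  On its units
   there is a continuous homomorphism into a real vector space, log|.| of the
   characters plus the logarithm of the unipotent part, and its values on the
   units where the affine character is 1 span (over R) a space W whose complex
   span is the n-dimensional kernel of that character; so dim_R W >= n.  With at
   most n generators there is then a linear functional, nonzero on W, which is
   integral on the logarithms of the generators, hence on those of all of G.  By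
   density and continuity it is integral on the logarithms of all those units,
   which contain one-parameter families, so it vanishes on W: contradiction. *)
From HB Require Import structures.
Require Import Defs.
From mathcomp Require Import all_boot all_order all_algebra.
From mathcomp Require Import all_classical all_reals all_analysis.
From mathcomp Require Import complex.
Set Implicit Arguments.
Unset Strict Implicit.
Unset Printing Implicit Defensive.
Import Order.TTheory GRing.Theory Num.Theory.
Import numFieldNormedType.Exports.
Local Open Scope classical_set_scope.
Local Open Scope ring_scope.
Local Open Scope complex_scope.

(** * Commutative matrix algebras: idempotents and characters *)

Section MatrixForm.
Variables (C : comNzRingType) (n : nat).

(** When [v] is a common left eigenvector and [v *m z = 1%:M], this form returns the eigenvalue of
    [X]. The characters below all have this shape, which makes them linear on the whole matrix
    space. *)
Definition mxform (v : 'rV[C]_n) (z : 'cV[C]_n) (X : 'M[C]_n) : C :=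
  (v *m X *m z) 0 0.

Fact mxform_is_scalar v z : scalar (mxform v z).
Proof.
by move=> a X Y; rewrite /mxform mulmxDr mulmxDl -scalemxAr -scalemxAl !mxE.
Qed.

HB.instance Definition _ v z :=
  GRing.isLinear.Build C 'M[C]_n C *%R (mxform v z) (mxform_is_scalar v z).

End MatrixForm.

Record comm_subalgebra (F : fieldType) n (S : 'M[F]_n.+1 -> Prop) : Prop := {
  subalg1 : S 1;
  subalgZ : forall a X, S X -> S (a *: X);
  subalgD : forall X Y, S X -> S Y -> S (X + Y);
  subalgM : forall X Y, S X -> S Y -> S (X * Y);
  subalgC : forall X Y, S X -> S Y -> X * Y = Y * X
}.

(* The e i are complete orthogonal idempotents of S, and lam i is the
   character of the local algebra S * e i. *)
Record local_splitting (F : fieldType) n (S : 'M[F]_n.+1 -> Prop) r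
    (e : 'I_r -> 'M[F]_n.+1) (lam : 'I_r -> {scalar 'M[F]_n.+1}) : Prop := {
  splitting_in : forall i, S (e i);
  splitting_orth : forall i j, e i * e j = if i == j then e i else 0;
  splitting_sum : \sum_i e i = 1;
  splitting_char1 : forall i, lam i (e i) = 1;
  splitting_charM : forall i X Y, S X -> S Y -> lam i (X * Y) = lam i X * lam i Y;
  splitting_nil : forall i X, S X -> (X - lam i X *: 1) ^+ n.+1 * e i = 0
}.

Section CommutativeMatrixAlgebra.
Variables (C : numClosedFieldType) (n m : nat).
Variables (B : 'I_m -> 'M[C]_n.+1) (S : 'M[C]_n.+1 -> Prop).
Hypothesis S_span : forall X, S X -> exists c : 'I_m -> C, X = \sum_j c j *: B j.
Hypothesis SB : forall j, S (B j).
Hypothesis S_alg : comm_subalgebra S.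

Let S1 : S 1 := subalg1 S_alg.
Let SZ : forall a X, S X -> S (a *: X) := subalgZ S_alg.
Let SD : forall X Y, S X -> S Y -> S (X + Y) := subalgD S_alg.
Let SM : forall X Y, S X -> S Y -> S (X * Y) := subalgM S_alg.
Let SC : forall X Y, S X -> S Y -> X * Y = Y * X := subalgC S_alg.

Lemma subalgB X Y : S X -> S Y -> S (X - Y).
Proof. by move=> SX SY; apply: SD => //; rewrite -scaleN1r; apply: SZ. Qed.

Lemma subalg_horner X (p : {poly C}) : S X -> S (horner_mx X p).
Proof.
move=> SX; elim/poly_ind: p => [|p c IH].
  by rewrite rmorph0 -(scale0r 1); apply: SZ.
rewrite rmorphD rmorphM /= horner_mx_X horner_mx_C -scalemx1.
by apply: SD; [exact: SM | exact: SZ].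
Qed.

(** Everything in [S] commutes with [e] and so acts on its row space; over an algebraically closed
    field the commuting restrictions of the spanning [B j] share an eigenvector there. *)
Lemma idempotent_eigenvector e : S e -> e * e = e -> e != 0 ->
  exists (v : 'rV[C]_n.+1) (z : 'cV[C]_n.+1),
    [/\ v *m z = 1%:M, v *m e = v
      & forall X, S X -> v *m X = (v *m X *m z) 0 0 *: v].
Proof.
move=> Se ee e0.
have st (j : 'I_m) : stablemx e (B j).
  by apply/submxP; exists (B j); exact: SC.
have [||w w0 /allP wB] :=
  @common_eigenvector C (\rank e) [seq restrictmx e (B j) | j <- enum 'I_m].
- by rewrite lt0n mxrank_eq0.
- move=> _ _ /mapP[j _ ->] /mapP[k _ ->]; rewrite /comm_mx.
  by rewrite -!conjmxM ?inE ?stablemx_row_base// ?st//; congr conjmx; exact: SC.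
pose v := w *m row_base e.
have v0 : v != 0 by rewrite mulmx_free_eq0 ?row_base_free.
have ve : v *m e = v.
  have /submxP[D ->] : (v <= e)%MS by rewrite mulmx_sub // eq_row_base.
  by rewrite -mulmxA -[e *m e]/(e * e) ee.
have vB j : exists a, v *m B j = a *: v.
  have : stablemx w (restrictmx e (B j)).
    by apply: wB; apply/mapP; exists j; rewrite ?mem_enum.
  by rewrite stablemx_restrict // => /sub_rVP.
clearbody v; have [i vi] : exists i, v 0 i != 0.
  apply/existsP; apply: contraNT v0 => /existsPn v_0.
  apply/eqP/rowP => i; rewrite mxE.
  by have := v_0 i; rewrite negbK => /eqP.
have vz : v *m ((v 0 i)^-1 *: delta_mx i (0 : 'I_1)) = 1%:M.
  apply/matrixP => a b; rewrite !ord1 -scalemxAr -colE !mxE mulVf //=.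
exists v, ((v 0 i)^-1 *: delta_mx i 0); split => // X /S_span[c ->].
have [a vXa] : exists a, v *m (\sum_j c j *: B j) = a *: v.
  have [a vBa] := choice vB.
  exists (\sum_j c j * a j); rewrite mulmx_sumr scaler_suml.
  by apply: eq_bigr => j _; rewrite -scalemxAr vBa scalerA.
by rewrite vXa -scalemxAl vz !mxE mulr1.
Qed.

Definition indecomposable e :=
  [/\ S e, e * e = e, e != 0
    & forall f, S f -> f * f = f -> f * e = f -> f = 0 \/ f = e].

(** Equal ranks would give equal row spaces, hence [e = D *m f] and [e * f = e], whereas
    [e * f = f]. This is the termination measure for splitting idempotents. *)
Lemma idempotent_rank_lt e f : S e -> S f -> e * e = e -> f * f = f ->
  f * e = f -> f <> e -> (\rank f < \rank e)%N.
Proof.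
move=> Se Sf ee ff fe nfe; rewrite ltnNge; apply/negP => le_ef.
have sfe : (f <= e)%MS by rewrite -fe; exact: submxMl.
have : (e <= f)%MS.
  move: (geq_leqif (mxrank_leqif_sup sfe)).
  by rewrite le_ef => /esym.
case/submxP => D De; apply: nfe.
have DS : e * f = D *m (f *m f) by rewrite mulmxA -De.
by rewrite -fe SC // DS -[f *m f]/(f * f) ff.
Qed.

(** Induction on the rank: an idempotent [f] strictly below [e] splits it into the orthogonal pieces
    [f] and [e - f], both of smaller rank. *)
Lemma indecomposable_seq e : S e -> e * e = e ->
  exists s : seq 'M[C]_n.+1,
    [/\ forall f, f \in s -> indecomposable f, forall f, f \in s -> f * e = f,
        pairwise (fun f g => f * g == 0) s & \sum_(f <- s) f = e].
Proof.
have [k ltk] := ubnP (\rank e); elim: k => [//|k IH] in e ltk * => Se ee.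
have [->|e0] := eqVneq e 0.
  by exists [::]; split => //; rewrite big_nil.
have [[f [Sf ff fe f0 nfe]]|prim] :=
  pselect (exists f, [/\ S f, f * f = f, f * e = f, f <> 0 & f <> e]); last first.
  exists [:: e]; split => //; rewrite ?big_seq1 //.
    move=> f0; rewrite inE => /eqP -> {f0}; split => // f Sf ff fe.
    have [->|f0] := pselect (f = 0); first by left.
    have [->|nfe] := pselect (f = e); first by right.
    by case: prim; exists f.
  by move=> f; rewrite inE => /eqP ->.
have Sg : S (e - f) by exact: subalgB.
have ef : e * f = f by rewrite SC.
have gg : (e - f) * (e - f) = e - f.
  by rewrite mulrBl !mulrBr ee ef fe ff subrr subr0.
have ge : (e - f) * e = e - f by rewrite mulrBl ee fe.
have fg : f * (e - f) = 0 by rewrite mulrBr fe ff subrr.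
have nge : e - f <> e.
  by move=> /eqP; rewrite -subr_eq0 addrAC subrr add0r oppr_eq0 => /eqP.
have lt_f := idempotent_rank_lt Se Sf ee ff fe nfe.
have lt_g := idempotent_rank_lt Se Sg ee gg ge nge.
have [s [s_ind s_f s_orth s_sum]] := IH f (leq_trans lt_f ltk) Sf ff.
have [t [t_ind t_g t_orth t_sum]] := IH (e - f) (leq_trans lt_g ltk) Sg gg.
exists (s ++ t); split.
- by move=> h; rewrite mem_cat => /orP[/s_ind|/t_ind].
- move=> h; rewrite mem_cat => /orP[hs|ht].
    by rewrite -(s_f h hs) -mulrA fe.
  by rewrite -(t_g h ht) -mulrA ge.
- rewrite pairwise_cat s_orth t_orth !andbT; apply/allrelP => a b a_s b_t /=.
  have [Sb _ _ _] := t_ind b b_t.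
  by rewrite -(s_f a a_s) -(t_g b b_t) (SC Sb Sg) mulrA -(mulrA a) fg mulr0 mul0r.
- by rewrite big_cat /= s_sum t_sum addrC subrK.
Qed.

(* The character of e kills the idempotent that Bezout attaches to the
   eigenvalue part of char_poly X, so indecomposability makes it vanish. *)
Lemma indecomposable_nilpotent e (v : 'rV[C]_n.+1) (z : 'cV[C]_n.+1) X :
  indecomposable e -> v *m z = 1%:M -> v *m e = v ->
  (forall X, S X -> v *m X = (v *m X *m z) 0 0 *: v) -> S X ->
  (X - (v *m X *m z) 0 0 *: 1) ^+ n.+1 * e = 0.
Proof.
move=> [Se ee e0 ind] vz ve vS SX; set a := (v *m X *m z) 0 0.
have v0 : v != 0.
  apply/eqP => v_0; move: vz; rewrite v_0 mul0mx => /matrixP/(_ 0 0).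
  by rewrite !mxE => /eqP; rewrite eq_sym oner_eq0.
have vh p : v *m horner_mx X p = p.[a] *: v.
  elim/poly_ind: p => [|p c IH].
    by rewrite rmorph0 mulmx0 horner0 scale0r.
  rewrite rmorphD rmorphM /= horner_mx_X horner_mx_C hornerMXaddC mulmxDr.
  rewrite -[horner_mx X p * X]/(horner_mx X p *m X) mulmxA IH -scalemxAl vS //.
  by rewrite -/a scalerA mul_mx_scalar scalerDl.
have ch0 : char_poly X != 0 by rewrite monic_neq0 // char_poly_monic.
have [k [q]] := multiplicity_XsubC (char_poly X) a.
rewrite ch0 /= => qa chq.
(* If [k = 0], then [q] is [char_poly X], and Cayley-Hamilton applied to [v] forces [q.[a] = 0],
   against [qa]. *)
have k0 : (0 < k)%N.
  case: k chq => // /[!expr0] /[!mulr1] chq.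
  have := vh q; rewrite -chq Cayley_Hamilton mulmx0 => /esym/eqP.
  by rewrite scaler_eq0 chq (negPf v0) orbF -[_ == 0]/(root q a) (negPf qa).
have kn : (k <= n.+1)%N.
  have : (size (('X - a%:P) ^+ k) <= size (char_poly X))%N.
    by apply: dvdp_leq => //; rewrite chq dvdp_mull.
  by rewrite size_char_poly size_exp_XsubC.
have cop : coprimep (('X - a%:P) ^+ k) q.
  by rewrite coprimep_expl // coprimep_sym coprimep_XsubC.
have /Bezout_eq1_coprimepP[[u w] /= uw] := cop.
(* [Z] is the spectral projection of [X] for the eigenvalue [a] and [Y] the complementary one;
   [v *m Y = 0] because [u * ('X - a%:P) ^+ k] vanishes at [a]. *)
pose Y := horner_mx X (u * ('X - a%:P) ^+ k).
pose Z := horner_mx X (w * q).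
have YZ1 : Y + Z = 1 by rewrite -rmorphD /= uw rmorph1.
have YZ0 : Y * Z = 0.
  rewrite -rmorphM /=.
  have -> : u * ('X - a%:P) ^+ k * (w * q) = u * w * char_poly X.
    by rewrite chq mulrACA (mulrC _ q).
  by rewrite rmorphM /= Cayley_Hamilton mulr0.
have SY : S Y by exact: subalg_horner.
have YY : Y * Y = Y by rewrite -[RHS]mulr1 -YZ1 mulrDr YZ0 addr0.
have [|||Ye|Ye] := ind (Y * e).
- exact: SM.
- by rewrite -mulrA (mulrA e) (SC Se SY) -(mulrA Y) ee mulrA YY.
- by rewrite -mulrA ee.
- have Ze : Z * e = e by rewrite -[RHS]mul1r -YZ1 mulrDl Ye add0r.
  have -> : (X - a *: 1) ^+ n.+1 = (X - a *: 1) ^+ (n.+1 - k) * (X - a *: 1) ^+ k.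
    by rewrite -exprD subnK.
  rewrite -Ze mulrA.
  have -> : (X - a *: 1) ^+ k = horner_mx X (('X - a%:P) ^+ k).
    by rewrite rmorphXn rmorphB /= horner_mx_X horner_mx_C scalemx1.
  rewrite -(mulrA _ _ Z) -rmorphM /=.
  have -> : ('X - a%:P) ^+ k * (w * q) = w * char_poly X.
    by rewrite chq mulrCA (mulrC _ q).
  by rewrite rmorphM /= Cayley_Hamilton mulr0 mulr0 mul0r.
- have : v *m (Y * e) = v by rewrite Ye.
  rewrite -[Y * e]/(Y *m e) mulmxA vh -scalemxAl ve hornerM horner_exp.
  rewrite hornerXsubC subrr expr0n gtn_eqF // mulr0 scale0r => /esym/eqP.
  by rewrite (negPf v0).
Qed.

(** The unit is split into indecomposables; the common eigenvector attached to [e i] supplies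
    [lam i], which is multiplicative because that vector is an eigenvector for all of [S]. *)
Lemma idempotent_decomposition :
  exists (r : nat) (e : 'I_r -> 'M[C]_n.+1) (lam : 'I_r -> {scalar 'M[C]_n.+1}),
  local_splitting S e lam.
Proof.
have [s [s_ind _ s_orth s_sum]] := indecomposable_seq S1 (mulr1 1).
pose e (i : 'I_(size s)) := s`_i.
have e_ind i : indecomposable (e i) by apply: s_ind; rewrite mem_nth.
have exv i : exists vz : 'rV[C]_n.+1 * 'cV[C]_n.+1,
    [/\ vz.1 *m vz.2 = 1%:M, vz.1 *m e i = vz.1
      & forall X, S X -> vz.1 *m X = mxform vz.1 vz.2 X *: vz.1].
  have [Se ee e0 _] := e_ind i.
  by have [v [z vzP]] := idempotent_eigenvector Se ee e0; exists (v, z).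
have [vz vzP] := choice exv.
exists (size s), e, (fun i => mxform (vz i).1 (vz i).2).
split => [i|i j||i|i X Y SX SY|i X SX].
- by case: (e_ind i).
- have orth (k l : 'I_(size s)) : (k < l)%N -> e k * e l = 0.
    by move=> kl; apply/eqP; apply: (pairwiseP 0 s_orth); rewrite ?inE.
  case: eqVneq => [<-|ne]; first by case: (e_ind i).
  have [Si _ _ _] := e_ind i; have [Sj _ _ _] := e_ind j.
  case: (ltngtP i j) => [/orth//|/orth|/val_inj/eqP]; last by rewrite (negPf ne).
  by rewrite SC.
- by rewrite -s_sum (big_nth 0) big_mkord.
- by case: (vzP i) => vz1 ve _; rewrite /= /mxform ve vz1 mxE.
- case: (vzP i) => vz1 _ vS /=.
  rewrite {1}/mxform -[X * Y]/(X *m Y) mulmxA vS // -scalemxAl vS // -!scalemxAl.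
  by rewrite vz1 !mxE mulr1.
- by case: (vzP i) => vz1 ve vS; exact: indecomposable_nilpotent.
Qed.

End CommutativeMatrixAlgebra.

(** * Logarithm of unipotent matrices *)

Section UnipotentLog.
Variables (C : numFieldType).

Definition binomial_poly k : {poly C} :=
  k`!%:R^-1 *: \prod_(i < k) ('X - i%:R%:P).

Lemma binomial_poly_nat k m : (binomial_poly k).[m%:R] = 'C(m, k)%:R.
Proof.
rewrite hornerZ horner_prod.
suff -> : \prod_(i < k) ('X - i%:R%:P).[m%:R] = (m ^_ k)%:R :> C.
  by rewrite -bin_ffact natrM mulrCA mulVf ?mulr1 // pnatr_eq0 -lt0n fact_gt0.
under eq_bigr do rewrite hornerXsubC.
have [km|mk] := leqP k m.
  rewrite ffact_prod natr_prod; apply: eq_bigr => i _.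
  by rewrite natrB // (leq_trans _ km) // ltnW.
by rewrite ffact_small // (bigD1 (Ordinal mk)) //= subrr mul0r.
Qed.

Lemma poly_eq_nat (p q : {poly C}) : (forall m : nat, p.[m%:R] = q.[m%:R]) -> p = q.
Proof.
move=> pq; apply/eqP; rewrite -subr_eq0; apply/eqP.
apply: (@roots_geq_poly_eq0 _ _ [seq i%:R | i <- iota 0 (size (p - q))]).
- by apply/allP => _ /mapP[m _ ->]; rewrite rootE hornerD hornerN pq subrr.
- rewrite map_inj_uniq ?iota_uniq // => i j /eqP.
  by rewrite eqr_nat => /eqP.
- by rewrite size_map size_iota.
Qed.

(** These are the Taylor coefficients of log(1 + x): 0 for [k = 0] and (-1)^(k-1)/k otherwise.
    Written as derivatives at 0 of binomial polynomials, they make the logarithm the derivative of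
    [x ^+ m] in [m]. *)
Definition log_coef k : C := (binomial_poly k)^`().[0].

Lemma log_coef0 : log_coef 0 = 0.
Proof. by rewrite /log_coef /binomial_poly big_ord0 -mul_polyC mulr1 derivC horner0. Qed.

Lemma log_coef1 : log_coef 1 = 1.
Proof.
by rewrite /log_coef /binomial_poly big_ord1 factS fact0 muln1 invr1 scale1r
  subr0 derivX hornerC.
Qed.

Variable n : nat.
Implicit Types x y : 'M[C]_n.+1.

Definition mxlog x := \sum_(k < n.+1) log_coef k *: (x - 1) ^+ k.

(** The binomial expansion of [1 + (x - 1)], with a length independent of [m]: terms past [n] die by
    nilpotency, terms past [m] by the binomial coefficient. Hence the entries of [x ^+ m] are
    polynomial in [m]. *)
Lemma expr_nilpotent_bin x m : (x - 1) ^+ n.+1 = 0 ->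
  x ^+ m = \sum_(k < n.+1) 'C(m, k)%:R *: (x - 1) ^+ k.
Proof.
move=> x0; pose F k := 'C(m, k)%:R *: (x - 1) ^+ k.
have widen a b : (a <= b)%N -> (forall k, (a <= k)%N -> F k = 0) ->
    \sum_(k < a) F k = \sum_(k < b) F k.
  move=> ab F0; rewrite (big_ord_widen b F ab) big_mkcond /=.
  by apply: eq_bigr => k _; case: ltnP => // ak; rewrite F0.
rewrite -[x in LHS](subrK 1) [x - 1 + 1]addrC exprDn_comm; last exact/commr_sym/commr1.
rewrite (eq_bigr (fun k : 'I_m.+1 => F k)); last first.
  by move=> k _; rewrite expr1n mul1r -scaler_nat.
rewrite (widen _ (m.+1 + n.+1)%N) ?leq_addr //; last first.
  by move=> k mk; rewrite /F bin_small // scale0r.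
rewrite (widen n.+1 (m.+1 + n.+1)%N) ?leq_addl // => k nk.
by rewrite /F -(subnK nk) exprD x0 mulr0 scaler0.
Qed.

Let pw x (i j : 'I_n.+1) : {poly C} :=
  \sum_(k < n.+1) ((x - 1) ^+ k) i j *: binomial_poly k.

Let pw_nat x i j m : (x - 1) ^+ n.+1 = 0 -> (pw x i j).[m%:R] = (x ^+ m) i j.
Proof.
move=> x0; rewrite (expr_nilpotent_bin m x0) horner_sum summxE.
by apply: eq_bigr => k _; rewrite hornerZ binomial_poly_nat mxE mulrC.
Qed.

Let pw_deriv x i j : (pw x i j)^`().[0] = mxlog x i j.
Proof.
rewrite [deriv _]linear_sum horner_sum summxE.
by apply: eq_bigr => k _ /=; rewrite derivZ hornerZ mxE mulrC.
Qed.

(* (x * y) ^+ m = x ^+ m * y ^+ m holds entrywise between polynomials in m;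
   differentiating at m = 0 gives the additivity of the logarithm. *)
Lemma mxlogM x y : x * y = y * x -> (x - 1) ^+ n.+1 = 0 -> (y - 1) ^+ n.+1 = 0 ->
  (x * y - 1) ^+ n.+1 = 0 -> mxlog (x * y) = mxlog x + mxlog y.
Proof.
move=> xy x0 y0 xy0; apply/matrixP => i j.
have -> : mxlog (x * y) i j = (\sum_l pw x i l * pw y l j)^`().[0].
  rewrite -pw_deriv; congr (_^`().[0]); apply: poly_eq_nat => m.
  rewrite pw_nat // exprMn_comm // -[_ * _]/(_ *m _) mxE horner_sum.
  by apply: eq_bigr => l _; rewrite hornerM !pw_nat.
have one z k l : (z - 1) ^+ n.+1 = 0 -> (pw z k l).[0] = (1 : 'M[C]_n.+1) k l.
  by move=> z0; rewrite -[0]/(0%:R) pw_nat.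
rewrite [deriv _]linear_sum horner_sum.
rewrite (eq_bigr (fun l => (mxlog x i l * (1 : 'M[C]_n.+1) l j) +
   ((1 : 'M[C]_n.+1) i l * mxlog y l j))); last first.
  by move=> l _ /=; rewrite derivM hornerD !hornerM !pw_deriv !one.
rewrite big_split /= mxE; congr (_ + _).
  by rewrite -[mxlog x in RHS]mulr1 -[mxlog x * 1]/(_ *m _) mxE.
by rewrite -[mxlog y in RHS]mul1r -[1 * mxlog y]/(_ *m _) mxE.
Qed.

End UnipotentLog.

(** * Logarithm on the units of a commutative matrix algebra *)

Section AlgebraLog.
Variables (C : numFieldType) (n : nat) (S : 'M[C]_n.+1 -> Prop).
Hypothesis S_alg : comm_subalgebra S.

Let S1 : S 1 := subalg1 S_alg.
Let SZ : forall a X, S X -> S (a *: X) := subalgZ S_alg.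
Let SD : forall X Y, S X -> S Y -> S (X + Y) := subalgD S_alg.
Let SM : forall X Y, S X -> S Y -> S (X * Y) := subalgM S_alg.
Let SC : forall X Y, S X -> S Y -> X * Y = Y * X := subalgC S_alg.

Variables (r : nat) (e : 'I_r -> 'M[C]_n.+1) (lam : 'I_r -> {scalar 'M[C]_n.+1}).
Hypothesis e_lam : local_splitting S e lam.

Let Se : forall i, S (e i) := splitting_in e_lam.
Let ee : forall i j, e i * e j = if i == j then e i else 0 := splitting_orth e_lam.
Let e_sum : \sum_i e i = 1 := splitting_sum e_lam.
Let lam_e : forall i, lam i (e i) = 1 := splitting_char1 e_lam.
Let lamM : forall i X Y, S X -> S Y -> lam i (X * Y) = lam i X * lam i Y :=
  splitting_charM e_lam.
Let lam_nil : forall i X, S X -> (X - lam i X *: 1) ^+ n.+1 * e i = 0 :=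
  splitting_nil e_lam.

Variable g : C -> C.
Hypothesis gM : forall a b, a != 0 -> b != 0 -> g (a * b) = g a + g b.

Lemma lam1 i : lam i 1 = 1.
Proof. by rewrite -[RHS](lam_e i) -[e i in RHS]mul1r lamM // lam_e mulr1. Qed.

Lemma lam_eE i j : lam i (e j) = (i == j)%:R.
Proof.
case: eqVneq => [<-//|ij].
by rewrite -[LHS]mul1r -(lam_e i) -lamM // ee (negPf ij) linear0.
Qed.

Let g1 : g 1 = 0.
Proof. by apply: (addrI (g 1)); rewrite -gM ?oner_eq0 // mulr1 addr0. Qed.

Let mul_blocks i j X Y : S Y ->
  X * e i * (Y * e j) = if i == j then X * Y * e i else 0.
Proof.
move=> SY; rewrite mulrA -(mulrA X) (SC (Se i) SY) -!mulrA ee.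
by case: eqP => [->|_]; rewrite ?mulr0.
Qed.

Lemma sum_idempotentX (y : 'I_r -> 'M[C]_n.+1) k : (forall i, S (y i)) ->
  (\sum_i y i * e i) ^+ k = \sum_i y i ^+ k * e i.
Proof.
move=> Sy; elim: k => [|k IH].
  by rewrite expr0 -e_sum; apply: eq_bigr => i _; rewrite expr0 mul1r.
rewrite exprS IH mulr_suml; apply: eq_bigr => i _.
have Syk j : S (y j ^+ k) by elim: k {IH} => [//|k]; rewrite exprS; exact: SM.
rewrite mulr_sumr (bigD1 i) //= big1 ?addr0 => [|j ji]; rewrite mul_blocks //.
  by rewrite eqxx -exprS.
by rewrite eq_sym (negPf ji).
Qed.

(** The unipotent factor of the multiplicative Jordan decomposition: each block is divided by its
    only eigenvalue. *)
Definition unipotent_part X := \sum_i ((lam i X)^-1 *: X) * e i.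

Lemma unipotent_partM X Y : S X -> S Y ->
  unipotent_part (X * Y) = unipotent_part X * unipotent_part Y.
Proof.
move=> SX SY; rewrite /unipotent_part mulr_suml; apply: eq_bigr => i _.
rewrite mulr_sumr (bigD1 i) //= big1 ?addr0 => [|j ji]; rewrite mul_blocks ?eqxx //;
  try exact: SZ.
  by congr (_ * _); rewrite lamM // invfM -scalerAl -scalerAr scalerA.
by rewrite eq_sym (negPf ji).
Qed.

Lemma unipotent_part_nil X : S X -> (forall i, lam i X != 0) ->
  (unipotent_part X - 1) ^+ n.+1 = 0.
Proof.
move=> SX X0.
have -> : unipotent_part X - 1 = \sum_i ((lam i X)^-1 *: (X - lam i X *: 1)) * e i.
  rewrite /unipotent_part -[X in _ - X = _]e_sum -sumrB; apply: eq_bigr => i _.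
  by rewrite scalerBr mulrBl scalerA mulVf // scale1r mul1r.
rewrite sum_idempotentX => [|i].
  by rewrite big1 // => i _; rewrite exprZn -scalerAl lam_nil // scaler0.
by apply: SZ; apply: SD => //; rewrite -scaleNr; apply: SZ.
Qed.

Lemma unipotent_part_in X : S X -> S (unipotent_part X).
Proof.
move=> SX; rewrite /unipotent_part; apply: (big_ind S) => //.
  by rewrite -(scale0r 1); apply: SZ.
by move=> i _; apply: SM => //; apply: SZ.
Qed.

(** The map [g] will be the logarithm of the modulus. Unlike a branch of the complex logarithm, it
    is additive on all nonzero scalars and continuous there. *)
Definition algebra_log X := mxlog (unipotent_part X) + \sum_i g (lam i X) *: e i.

Lemma algebra_logM X Y : S X -> S Y ->
  (forall i, lam i X != 0) -> (forall i, lam i Y != 0) ->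
  algebra_log (X * Y) = algebra_log X + algebra_log Y.
Proof.
move=> SX SY X0 Y0.
have XY0 i : lam i (X * Y) != 0 by rewrite lamM // mulf_neq0.
rewrite /algebra_log unipotent_partM // mxlogM; first last.
- by rewrite -unipotent_partM // unipotent_part_nil //; exact: SM.
- exact: unipotent_part_nil.
- exact: unipotent_part_nil.
- by apply: SC; exact: unipotent_part_in.
rewrite addrACA; congr (_ + _); rewrite -big_split; apply: eq_bigr => i _ /=.
by rewrite lamM // gM // scalerDl.
Qed.

(** On this line of units the logarithm is polynomial in [t] with linear coefficient [a], which is
    how nilpotent directions are tested. *)
Lemma algebra_log_unipotent a t : S a -> (forall i, lam i a = 0) ->
  algebra_log (1 + t *: a) = \sum_(k < n.+1) (log_coef C k * t ^+ k) *: a ^+ k.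
Proof.
move=> Sa a0.
have l1 i : lam i (1 + t *: a) = 1 by rewrite linearD linearZ /= a0 mulr0 addr0 lam1.
have -> : algebra_log (1 + t *: a) = mxlog (1 + t *: a).
  rewrite /algebra_log [X in mxlog _ + X]big1 ?addr0 => [|i _]; last first.
    by rewrite l1 g1 scale0r.
  congr mxlog; rewrite -[RHS]mulr1 -[X in _ = _ * X]e_sum mulr_sumr.
  by apply: eq_bigr => i _; rewrite l1 invr1 scale1r.
by apply: eq_bigr => k _; rewrite addrAC subrr add0r exprZn scalerA.
Qed.

Lemma lam_scale_idempotent i j s : lam i (1 + (s - 1) *: e j) = if i == j then s else 1.
Proof.
rewrite linearD linearZ /= lam1 lam_eE; case: eqP => _.
  by rewrite mulr1 addrC subrK.
by rewrite mulr0 addr0.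
Qed.

(** The argument is [s] on block [j] and 1 on the others, so its unipotent part is 1 and only the
    [g] term survives. *)
Lemma algebra_log_scale_idempotent j s : s != 0 ->
  algebra_log (1 + (s - 1) *: e j) = g s *: e j.
Proof.
move=> s0; rewrite /algebra_log.
have -> : unipotent_part (1 + (s - 1) *: e j) = 1.
  rewrite -[RHS]e_sum /unipotent_part; apply: eq_bigr => i _.
  rewrite lam_scale_idempotent -scalerAl mulrDl mul1r -scalerAl ee eq_sym.
  case: eqVneq => [<-|_]; last by rewrite scaler0 addr0 invr1 scale1r.
  by rewrite -{1}[e j]scale1r -scalerDl addrC subrK scalerA mulVf // scale1r.
have -> : mxlog 1 = 0 :> 'M[C]_n.+1.
  rewrite /mxlog big1 // => k _; rewrite subrr expr0n.
  by case: eqP => [->|_]; rewrite ?log_coef0 ?scale0r ?scaler0.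
rewrite add0r (bigD1 j) //= lam_scale_idempotent eqxx big1 ?addr0 // => i ij.
by rewrite lam_scale_idempotent (negPf ij) g1 scale0r.
Qed.

Definition semisimple_part X := \sum_i lam i X *: e i.

Lemma nilpotent_part_lam X i : S X -> lam i (X - semisimple_part X) = 0.
Proof.
move=> SX; rewrite linearB /= /semisimple_part linear_sum /= (bigD1 i) //=.
rewrite linearZ /= lam_e mulr1 big1 ?addr0 ?subrr // => j ji.
by rewrite linearZ /= lam_eE eq_sym (negPf ji) mulr0.
Qed.

Lemma semisimple_part_in X : S (semisimple_part X).
Proof.
apply: (big_ind S) => //; last by move=> i _; apply: SZ.
by rewrite -(scale0r 1); apply: SZ.
Qed.

(** Since the [e i] sum to 1, [chi] is nonzero on some [e i]; nilpotency of [X - lam i X *: 1] on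
    that block then forces [chi X = lam i X]. *)
Lemma character_lam (chi : {scalar 'M[C]_n.+1}) : chi 1 = 1 ->
  (forall X Y, S X -> S Y -> chi (X * Y) = chi X * chi Y) ->
  exists i, forall X, S X -> chi X = lam i X.
Proof.
move=> chi1 chiM.
have [i ei] : exists i, chi (e i) != 0.
  apply/existsP; apply: contra_eqT chi1 => /existsPn chi0.
  rewrite -e_sum linear_sum /= big1 => [|i _]; first by rewrite eq_sym oner_eq0.
  by apply/eqP; have := chi0 i; rewrite negbK.
exists i => X SX; pose Z := X - lam i X *: 1.
have SZi : S Z by apply: SD => //; rewrite -scaleNr; apply: SZ.
have SZk k : S (Z ^+ k) by elim: k => [//|k]; rewrite exprS; exact: SM.
have chiX k : chi (Z ^+ k) = chi Z ^+ k.
  by elim: k => [|k IH]; rewrite ?chi1 // !exprS chiM // IH.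
have := congr1 chi (lam_nil i SX); rewrite linear0 chiM // chiX => /eqP.
rewrite mulf_eq0 (negPf ei) orbF expf_eq0 /= /Z linearB linearZ /= chi1 mulr1.
by rewrite subr_eq0 => /eqP.
Qed.

End AlgebraLog.

(** * Bases from spanning sets, integral functionals, integer-valued polynomials *)

Section Bases.
Variable F : fieldType.

(** Greedy extension: while the rows of [W] do not span, a nonzero column of [cokermx W] is a
    functional vanishing on them, and a vector of [Q] outside its kernel enlarges the family. *)
Lemma spanning_basis k (Q : 'rV[F]_k -> Prop) :
  (forall c : 'cV[F]_k, c != 0 -> exists w, Q w /\ w *m c != 0) ->
  exists W : 'M[F]_k, W \in unitmx /\ forall i, Q (row i W).
Proof.
move=> Qc.
suff H m : (m <= k)%N -> exists W : 'M[F]_(m, k), row_free W /\ forall i, Q (row i W).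
  by have [W [Wf QW]] := H k (leqnn k); exists W; rewrite -row_free_unit.
elim: m => [|m IH] mk.
  exists 0; split; last by case.
  by rewrite /row_free mxrank0.
have [W [Wf QW]] := IH (ltnW mk).
have [j cj] : exists j, col j (cokermx W) != 0.
  apply/existsP; apply: contraLR mk => /existsPn c0.
  have : cokermx W == 0.
    apply/eqP/matrixP => a b; have /eqP/matrixP/(_ a 0) := negbNE (c0 b).
    by rewrite !mxE.
  by rewrite cokermx_eq0 /row_full (eqP Wf) -leqNgt => /eqP ->.
have [w [Qw wc]] := Qc _ cj.
have QwW (i : 'I_(1 + m)) : Q (row i (col_mx w W)).
  rewrite -(fintype.splitK i); case: (fintype.split i) => a /=;
    by rewrite ?rowKu ?rowKd // ord1 row_id.
exists (col_mx w W : 'M[F]_(1 + m, k)); split; last exact: QwW.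
have lt : (W < w + W)%MS.
  rewrite /ltmx addsmxSr; apply: contra wc => le.
  have /submxP[D ->] : (w <= W)%MS by apply: submx_trans le; exact: addsmxSl.
  by rewrite -mulmxA colE (mulmxA W) mulmx_coker mul0mx mulmx0.
move: lt; rewrite ltmxErank => /andP[_]; rewrite (eqP Wf) addsmxE => rk.
by rewrite /row_free eqn_leq rank_leq_row.
Qed.

End Bases.

(** The bound [p <= n] enters here. If [E] has rank below [n], a kernel vector gives the value 0
    everywhere; otherwise [p = n], [E] is invertible, and the preimage of a unit vector works. *)
Lemma integer_combination (F : archiRealFieldType) (n p : nat) (E : 'M[F]_(p, n)) :
  (0 < n)%N -> (p <= n)%N ->
  exists c : 'cV[F]_n, c != 0 /\ forall i, (E *m c) i 0 \is a Num.int.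
Proof.
move=> n0 pn.
have [full|nfull] := boolP (row_full E); last first.
  have [j cj] : exists j, col j (cokermx E) != 0.
    apply/existsP; apply: contraR nfull => /existsPn c0.
    rewrite -cokermx_eq0; apply/eqP/matrixP => a b.
    by have /eqP/matrixP/(_ a 0) := negbNE (c0 b); rewrite !mxE.
  exists (col j (cokermx E)); split => // i.
  by rewrite colE mulmxA mulmx_coker mul0mx mxE rpred0.
have pE : p = n.
  by apply/eqP; rewrite eqn_leq pn -(eqP full) rank_leq_row.
subst p; have Eu : E \in unitmx by rewrite -row_full_unit.
exists (invmx E *m delta_mx (Ordinal n0) 0); split; last first.
  by move=> i; rewrite mulKVmx // mxE; case: (_ && _); rewrite ?rpred0 ?rpred1.
apply: contraTN isT => /eqP /(congr1 (mulmx E)); rewrite mulmx0 mulKVmx //.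
by move=> /matrixP/(_ (Ordinal n0) 0); rewrite !mxE !eqxx => /eqP; rewrite oner_eq0.
Qed.

(** A nonzero integer value has absolute value at least 1, so by the intermediate value theorem [q]
    or [- q] would take the value 1/2 on the way from its zero at 0. *)
Lemma integer_valued_poly (F : archiRcfType) (q : {poly F}) :
  (forall t, q.[t] \is a Num.int) -> q.[0] = 0 -> q = 0.
Proof.
move=> q_int q0.
suff qt t : q.[t] = 0.
  by apply: poly_eq_nat => m; rewrite qt horner0.
have half : (2^-1 : F) \isn't a Num.int.
  apply/negP => /intrP[k /(congr1 ( *%R 2%:R))].
  rewrite mulfV ?pnatr_eq0 // -[2%:R]/(2%:~R) -[1]/(1%:~R) -intrM => /intr_inj/eqP.
  by case: k => -[|[]].
have ivt (p : {poly F}) (y : F) : p.[0] = 0 -> 2^-1 <= p.[y] ->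
    exists x, p.[x] = 2^-1.
  move=> p0 py; pose s := p - (2^-1)%:P.
  have s0 : s.[0] <= 0 by rewrite hornerD hornerN hornerC p0 sub0r oppr_le0 invr_ge0.
  have sy : 0 <= s.[y] by rewrite hornerD hornerN hornerC subr_ge0.
  suff [x] : exists x, root s x.
    by rewrite rootE hornerD hornerN hornerC subr_eq0 => /eqP; exists x.
  have [y0|y0] := leP 0 y.
    by have [x _ sx] := poly_ivt y0 (introT andP (conj s0 sy)); exists x.
  have := @poly_ivt F (- s) y 0 (ltW y0).
  rewrite !hornerN oppr_le0 oppr_ge0 sy s0 => /(_ isT)[x _].
  by rewrite rootN; exists x.
have one_le (z : F) : z \is a Num.int -> z != 0 -> 2^-1 <= `|z|.
  move=> zi z0; apply: le_trans (norm_intr_ge1 zi z0).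
  by rewrite invf_le1 ?ltr0n // ler1n.
apply/eqP; apply: contraT => qt0.
have := one_le _ (q_int t) qt0; have [qp|qn] := leP 0 q.[t].
  rewrite ger0_norm // => /(ivt q _ q0)[x qx].
  by move: half; rewrite -qx q_int.
rewrite ltr0_norm // -hornerN => /ivt[|x qx]; first by rewrite hornerN q0 oppr0.
by move: half; rewrite -qx hornerN rpredN q_int.
Qed.

(** * The algebra spanned by the group and evaluation at a cyclic vector *)

Section Commutant.
Variables (F : fieldType) (n : nat) (H : 'M[F]_n.+1 -> Prop).
Variables (B : 'I_n.+1 -> 'M[F]_n.+1) (u : 'cV[F]_n.+1) (W : 'M[F]_n.+1).
Hypothesis HH : forall X Y, H X -> H Y -> X * Y = Y * X.
Hypothesis HB : forall j, H (B j).
Hypothesis WB : forall j, row j W = (B j *m u)^T.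
Hypothesis Wu : W \in unitmx.

(** This plays the role of the span of the group matrices: closure under products is immediate, and
    [commutant_span] identifies it with the span of the [B j]. *)
Definition commutant X := forall Y, H Y -> X * Y = Y * X.

Lemma commutant_gen X : H X -> commutant X.
Proof. by move=> HX Y HY; exact: HH. Qed.

(** The inverse of evaluation at [u]: the coefficients are the coordinates of [x] in the basis
    [B j *m u], whose transposes are the rows of [W]. *)
Definition combo (x : 'cV[F]_n.+1) := \sum_j (x^T *m invmx W) 0 j *: B j.

Lemma combo_vec x : combo x *m u = x.
Proof.
apply: trmx_inj; rewrite -[RHS](mulmxKV Wu) mulmx_sum_row /combo mulmx_suml.
rewrite linear_sum /=; apply: eq_bigr => j _.
by rewrite WB -scalemxAl linearZ.
Qed.

Lemma commutant_combo x : commutant (combo x).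
Proof.
apply: (big_ind commutant) => [Y _|X Y SX SY Z HZ|j _ Y HY].
- by rewrite mul0r mulr0.
- by rewrite mulrDl mulrDr SX // SY.
- by rewrite -scalerAl -scalerAr (HH (HB j)).
Qed.

(** By commutation [X] sends [B j *m u] to [B j *m (X *m u)], so [X *m u] determines [X] on a
    basis. *)
Lemma commutant_inj X Y : commutant X -> commutant Y -> X *m u = Y *m u -> X = Y.
Proof.
move=> SX SY XY; apply: trmx_inj; rewrite -[LHS](mulKmx Wu) -[RHS](mulKmx Wu).
congr (_ *m _); apply/row_matrixP => j.
rewrite !row_mul !WB -!trmx_mul !mulmxA; congr (_ ^T).
rewrite -[X *m B j]/(X * B j) SX // -(mulmxA (B j) X u) XY mulmxA.
by rewrite -[Y *m B j]/(Y * B j) SY.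
Qed.

Lemma comboK X : commutant X -> combo (X *m u) = X.
Proof.
by move=> SX; apply: commutant_inj => //; [exact: commutant_combo | exact: combo_vec].
Qed.

Lemma commutant_span X : commutant X -> exists c : 'I_n.+1 -> F, X = \sum_j c j *: B j.
Proof.
by move=> SX; exists (fun j => ((X *m u)^T *m invmx W) 0 j); rewrite -[LHS]comboK.
Qed.

Lemma commutant_subalgebra : comm_subalgebra commutant.
Proof.
split => [Y _|a X SX Y HY|X Y SX SY Z HZ|X Y SX SY Z HZ|X Y SX].
- by rewrite mul1r mulr1.
- by rewrite -scalerAl -scalerAr SX.
- by rewrite mulrDl mulrDr SX // SY.
- by rewrite -mulrA SY // mulrA SX // mulrA.
(* Commutativity is not built into a commutant; it holds because one factor is a combination of the
   [B j], with which the other commutes. *)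
- move=> /commutant_span[c ->]; rewrite mulr_sumr mulr_suml.
  by apply: eq_bigr => j _; rewrite -scalerAl -scalerAr SX.
Qed.

Section FirstRow.
Hypothesis H0 : forall X, H X -> delta_mx 0 0 *m X = (delta_mx 0 0 : 'rV_n.+1).

(** The affine character: the first coordinate row is fixed by every group matrix, hence is a common
    left eigenvector of the algebra, and [chi] is its eigenvalue. *)
Let chi := mxform (delta_mx 0 0 : 'rV[F]_n.+1) (delta_mx 0 0).

Lemma commutant_row0 X : commutant X ->
  delta_mx 0 0 *m X = chi X *: (delta_mx 0 0 : 'rV_n.+1).
Proof.
move=> /commutant_span[c ->].
have -> : delta_mx 0 0 *m (\sum_j c j *: B j) =
    (\sum_j c j) *: (delta_mx 0 0 : 'rV_n.+1).
  rewrite mulmx_sumr scaler_suml; apply: eq_bigr => j _.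
  by rewrite -scalemxAr H0.
rewrite /chi linear_sum /=; congr (_ *: _); apply: eq_bigr => j _.
by rewrite linearZ /= /mxform H0 // mul_delta_mx mxE !eqxx mulr1.
Qed.

Lemma chiM X Y : commutant X -> commutant Y -> chi (X * Y) = chi X * chi Y.
Proof.
move=> SX SY; rewrite {1}/chi /mxform -[X * Y]/(X *m Y) mulmxA commutant_row0 //.
by rewrite -scalemxAl commutant_row0 // -!scalemxAl mul_delta_mx !mxE !eqxx mulr1.
Qed.

Lemma chi1 : chi 1 = 1.
Proof. by rewrite /chi /mxform mulmx1 mul_delta_mx mxE !eqxx. Qed.

Lemma chi_vec X : commutant X -> (X *m u) 0 0 = chi X * u 0 0.
Proof.
move=> SX; have row0 (x : 'cV[F]_n.+1) :
    x 0 0 = (delta_mx 0 (0 : 'I_n.+1) *m x) (0 : 'I_1) 0.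
  by rewrite -rowE mxE.
by rewrite (row0 (X *m u)) mulmxA commutant_row0 // -scalemxAl mxE -row0.
Qed.

End FirstRow.
End Commutant.

(** * Continuity of the logarithm *)

Lemma sum_continuous (K : numFieldType) (T : topologicalType) (x : T)
    (I : Type) (r : seq I) (s : I -> T -> K) :
  (forall i, {for x, continuous (s i)}) ->
  {for x, continuous (fun w => \sum_(i <- r) s i w)}.
Proof.
move=> cs; elim: r => [|i r IH].
  rewrite (_ : (fun _ => _) = fun=> 0); first exact: cst_continuous.
  by apply/funext => w; rewrite big_nil.
rewrite (_ : (fun _ => _) = fun w => s i w + \sum_(i <- r) s i w).
  by apply: continuousD.
by apply/funext => w; rewrite big_cons.
Qed.

Section EntrywiseContinuity.
Variables (K : numFieldType) (T : topologicalType) (n : nat) (x : T).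
Implicit Types (s t : T -> K) (f h : T -> 'M[K]_n.+1).

Let cD s t : {for x, continuous s} -> {for x, continuous t} ->
  {for x, continuous (fun w => s w + t w)}.
Proof. by move=> cs ct; exact: continuousD. Qed.

Let cM s t : {for x, continuous s} -> {for x, continuous t} ->
  {for x, continuous (fun w => s w * t w)}.
Proof. by move=> cs ct; exact: continuousM. Qed.

Definition entries_continuous f := forall a b, {for x, continuous (fun w => f w a b)}.

Lemma entries_cst X : entries_continuous (fun=> X).
Proof. by move=> a b; exact: cst_continuous. Qed.

Lemma entriesD f h : entries_continuous f -> entries_continuous h ->
  entries_continuous (fun w => f w + h w).
Proof.
move=> cf ch a b; rewrite (_ : (fun _ => _) = fun w => f w a b + h w a b).
  exact: cD.
by apply/funext => w; rewrite mxE.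
Qed.

Lemma entriesM f h : entries_continuous f -> entries_continuous h ->
  entries_continuous (fun w => f w * h w).
Proof.
move=> cf ch a b; rewrite (_ : (fun _ => _) = fun w => \sum_j f w a j * h w j b).
  by apply: sum_continuous => j; exact: cM.
by apply/funext => w; rewrite mxE.
Qed.

Lemma entriesZ s f : {for x, continuous s} -> entries_continuous f ->
  entries_continuous (fun w => s w *: f w).
Proof.
move=> cs cf a b; rewrite (_ : (fun _ => _) = fun w => s w * f w a b); first exact: cM.
by apply/funext => w; rewrite mxE.
Qed.

Lemma entries_sum (I : Type) (r : seq I) (f : I -> T -> 'M[K]_n.+1) :
  (forall i, entries_continuous (f i)) ->
  entries_continuous (fun w => \sum_(i <- r) f i w).
Proof.
move=> cf a b; rewrite (_ : (fun _ => _) = fun w => \sum_(i <- r) f i w a b).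
  by apply: sum_continuous => i; exact: cf.
by apply/funext => w; rewrite summxE.
Qed.

Lemma entriesX f k : entries_continuous f -> entries_continuous (fun w => f w ^+ k).
Proof.
move=> cf; elim: k => [|k IH]; first exact: entries_cst.
rewrite (_ : (fun _ => _) = fun w => f w * f w ^+ k); first exact: entriesM.
by apply/funext => w; rewrite exprS.
Qed.

Lemma entries_form (phi : {scalar 'M[K]_n.+1}) f : entries_continuous f ->
  {for x, continuous (fun w => phi (f w))}.
Proof.
move=> cf.
rewrite (_ : (fun _ => _) = fun w => \sum_a \sum_b f w a b * phi (delta_mx a b)).
  apply: sum_continuous => a; apply: sum_continuous => b.
  by apply: cM; [exact: cf | exact: cst_continuous].
apply/funext => w; rewrite {1}(matrix_sum_delta (f w)) linear_sum /=.
by apply: eq_bigr => a _; rewrite linear_sum; apply: eq_bigr => b _; rewrite linearZ.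
Qed.

Lemma entries_algebra_log r (e : 'I_r -> 'M[K]_n.+1) (lam : 'I_r -> {scalar 'M[K]_n.+1})
    (g : K -> K) f : entries_continuous f -> (forall i, lam i (f x) != 0) ->
  (forall z, z != 0 -> {for z, continuous g}) ->
  entries_continuous (fun w => algebra_log e lam g (f w)).
Proof.
move=> cf f0 cg; apply: entriesD.
  apply: entries_sum => k; apply: entriesZ; first exact: cst_continuous.
  apply: entriesX; apply: entriesD; last exact: entries_cst.
  apply: entries_sum => i; apply: entriesM; last exact: entries_cst.
  by apply: entriesZ => //; apply: continuousV; [exact: f0 | exact: entries_form].
apply: entries_sum => i; apply: entriesZ; last exact: entries_cst.
by apply: continuous_comp; [exact: entries_form | exact: cg].
Qed.

End EntrywiseContinuity.

Section ComplexContinuity.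
Variable R : realType.

Lemma Re_continuous : continuous (@complex.Re R : R[i] -> R).
Proof.
move=> z A /nbhs_ballP[e e0 eA]; apply/nbhs_ballP.
exists (e%:C); first by rewrite /= ltcR.
move=> y; rewrite /ball /= => zy; apply: eA; rewrite /ball /=.
by rewrite -ltcR; apply: le_lt_trans zy; rewrite -raddfB normc_ge_Re.
Qed.

Lemma real_complex_continuous : continuous (fun x : R => x%:C : R[i]).
Proof.
move=> x A /nbhs_ballP[e e0 eA]; apply/nbhs_ballP; exists (complex.Re e).
  by move: e0; rewrite /= ltcE => /andP[].
move=> y; rewrite /ball /= => xy; apply: eA; rewrite /ball /=.
rewrite -rmorphB normc_def /= expr0n addr0 sqrtr_sqr ltcE /=.
by move: e0; rewrite /= ltcE /= => /andP[/eqP <- _]; rewrite eqxx.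
Qed.

(** The norm on [R[i]] is itself complex-valued, hence [complex.Re]; the result is embedded back
    into [R[i]] so that it can serve as [g]. *)
Definition ln_normc (z : R[i]) : R[i] := (ln (complex.Re `|z|))%:C.

Lemma Re_norm_gt0 (z : R[i]) : z != 0 -> 0 < complex.Re `|z|.
Proof. by rewrite -normr_gt0 ltcE => /andP[]. Qed.

Lemma ln_normcM (a b : R[i]) : a != 0 -> b != 0 ->
  ln_normc (a * b) = ln_normc a + ln_normc b.
Proof.
move=> a0 b0; rewrite /ln_normc -rmorphD -lnM ?posrE ?Re_norm_gt0 //.
by rewrite -[complex.Re `|a * b|]/(Normc.normc (a * b)) Normc.normcM.
Qed.

Lemma ln_normc_continuous z : z != 0 -> {for z, continuous ln_normc}.
Proof.
move=> z0; apply: (@continuous_comp _ _ _ (fun z => ln (complex.Re `|z|))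
  (fun x : R => x%:C : R[i])).
  apply: (@continuous_comp _ _ _ (fun z => complex.Re `|z|) (@ln R)).
    apply: (@continuous_comp _ _ _ (fun z : R[i] => `|z|) (@complex.Re R)).
      exact: norm_continuous.
    exact: Re_continuous.
  by apply: continuous_ln; exact: Re_norm_gt0.
exact: real_complex_continuous.
Qed.

Lemma ln_normc_exp (t : R) : ln_normc (expR t)%:C = t%:C.
Proof.
rewrite /ln_normc -[complex.Re _]/(Normc.normc (expR t)%:C) /Normc.normc /= expr0n
  addr0 sqrtr_sqr.
by rewrite ger0_norm ?expR_ge0 // expRK.
Qed.

End ComplexContinuity.

(** * Homogenization of affine maps *)

Section AffineMatrix.
Variables (R : realType) (n : nat).
Local Notation C := R[i].

(** The matrix is recovered from the values of the function: the translation is [f 0], and the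
    columns are the differences [f (delta_mx b 0) - f 0]. The homogenizing coordinate comes
    first. *)
Definition affine_mx (f : 'cV[C]_n -> 'cV[C]_n) : 'M[C]_n.+1 :=
  block_mx (1%:M : 'M[R[i]]_1) 0 (f 0) (\matrix_(a, b) (f (delta_mx b 0) - f 0) a 0).

Definition affine_vec (w : 'cV[C]_n) : 'cV[C]_n.+1 := col_mx (1%:M : 'M[R[i]]_1) w.

Lemma affine_mxE A a :
  affine_mx (affine_map A a) = block_mx (1%:M : 'M[R[i]]_1) 0 a A.
Proof.
have a0 : affine_map A a 0 = a by rewrite /affine_map mulmx0 add0r.
rewrite /affine_mx a0 (_ : \matrix_(_, _) _ = A) //; apply/matrixP => b c.
by rewrite mxE /affine_map addrK -colE mxE.
Qed.

Lemma affine_mx_vec f w : GA f -> affine_mx f *m affine_vec w = affine_vec (f w).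
Proof.
move=> [A [a [_ ->]]]; rewrite affine_mxE /affine_vec.
rewrite (@mul_block_col _ 1 n 1 n 1) mul1mx mul0mx addr0 mulmx1.
by rewrite /affine_map addrC.
Qed.

Lemma affine_mxM f h : GA f -> GA h -> affine_mx (f \o h) = affine_mx f * affine_mx h.
Proof.
move=> [A [a [_ ->]]] [B [b [_ ->]]].
have -> : affine_map A a \o affine_map B b = affine_map (A *m B) (A *m b + a).
  by apply/funext => x; rewrite /affine_map /= mulmxDr mulmxA addrA.
rewrite !affine_mxE -[RHS]/(_ *m _) (@mulmx_block _ 1 n 1 n 1 n).
by rewrite !mul1mx !mulmx1 !mul0mx !mulmx0 !addr0 add0r addrC.
Qed.

Lemma affine_mx_row0 f : delta_mx 0 0 *m affine_mx f = (delta_mx 0 0 : 'rV_n.+1).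
Proof.
rewrite -rowE; apply/rowP => j.
have -> : (0 : 'I_n.+1) = lshift n (0 : 'I_1) by exact: val_inj.
rewrite mxE -(@fintype.splitK 1 n j); case: (fintype.split (j : 'I_(1 + n))) => b /=.
  by rewrite (@block_mxEul _ 1 n 1 n) !ord1 !mxE !eqxx.
by rewrite (@block_mxEur _ 1 n 1 n) !mxE.
Qed.
End AffineMatrix.

(** * A functional integral on the logarithms of the generators *)

Section Functional.
Variables (R : realType) (n : nat).
Local Notation C := R[i].
Variable S : 'M[C]_n.+1 -> Prop.
Hypothesis S_alg : comm_subalgebra S.

Let S1 : S 1 := subalg1 S_alg.
Let SZ : forall a X, S X -> S (a *: X) := subalgZ S_alg.
Let SD : forall X Y, S X -> S Y -> S (X + Y) := subalgD S_alg.
Let SM : forall X Y, S X -> S Y -> S (X * Y) := subalgM S_alg.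
Let SC : forall X Y, S X -> S Y -> X * Y = Y * X := subalgC S_alg.
Variables (r : nat) (e : 'I_r -> 'M[C]_n.+1) (lam : 'I_r -> {scalar 'M[C]_n.+1}).
Hypothesis e_lam : local_splitting S e lam.
Variables (k0 : 'I_r) (u : 'cV[C]_n.+1).
Hypothesis u_surj : forall x, exists2 X, S X & X *m u = x.
Hypothesis u_lam : forall X, S X -> (X *m u) 0 0 = lam k0 X.

(* The real span of these matrices is the target of the logarithm on the
   invertible elements at which lam k0 equals 1. *)
Definition log_direction Y :=
  S Y /\ ((forall k, lam k Y = 0) \/ exists2 k, k != k0 & Y = e k).

(** On log directions the discarded first coordinate of [Y *m u] is [lam k0 Y = 0], so nothing is
    lost. *)
Let vec (Y : 'M[C]_n.+1) : 'cV[C]_n := @dsubmx _ 1 n 1 (Y *m u).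

(** An element of the kernel of [lam k0] is its nilpotent part plus a combination of the [e k] with
    [k != k0]; by [u_surj] such elements reach every vector with first coordinate 0. *)
Let log_direction_span (c : 'cV[C]_n) : c != 0 ->
  exists w, (exists2 Y, log_direction Y & w = (vec Y)^T) /\ w *m c != 0.
Proof.
move=> c0; apply: contrapT => H; move/eqP: c0; apply.
have dir0 Y : log_direction Y -> (vec Y)^T *m c = 0.
  move=> dY; apply/eqP; apply: contrapT => /negP H0; apply: H.
  by exists (vec Y)^T; split => //; exists Y.
have all0 Y : S Y -> lam k0 Y = 0 -> (vec Y)^T *m c = 0.
  move=> SY Y0; rewrite -[Y](subrK (semisimple_part e lam Y)).
  have vecD X Z : vec (X + Z) = vec X + vec Z by rewrite /vec mulmxDl linearD.
  rewrite vecD linearD /= mulmxDl dir0 ?add0r; last first.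
    split; last by left => k; exact: (nilpotent_part_lam e_lam).
    apply: SD => //; rewrite -scaleN1r; apply: SZ.
    exact: (semisimple_part_in S_alg e_lam).
  have -> : vec (semisimple_part e lam Y) = \sum_k lam k Y *: vec (e k).
    rewrite /vec /semisimple_part mulmx_suml linear_sum; apply: eq_bigr => k _.
    by rewrite -scalemxAl linearZ.
  rewrite linear_sum mulmx_suml big1 // => k _.
  rewrite linearZ /= -scalemxAl; case: (eqVneq k k0) => [->|kk0].
    by rewrite Y0 scale0r.
  rewrite dir0 ?scaler0 //; split; first exact: (splitting_in e_lam).
  by right; exists k.
apply/colP => a; rewrite mxE.
have [X SX Xu] := u_surj (col_mx (0 : 'M[C]_1) (delta_mx a 0 : 'cV[C]_n)).
have X0 : lam k0 X = 0.
  have row0 : (0 : 'I_n.+1) = lshift n (0 : 'I_1) by exact: val_inj.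
  by rewrite -u_lam // Xu row0 (@col_mxEu _ 1 n 1) mxE.
have := all0 X SX X0; rewrite /vec Xu (@col_mxKd _ 1 n 1) trmx_delta -rowE.
by move=> /matrixP/(_ 0 0); rewrite !mxE.
Qed.

(** In a complex basis of log directions, the real parts of the coordinates of the [X j] form a real
    matrix [E] with [p] rows, to which [integer_combination] applies. *)
Lemma integer_functional p (X : 'I_p -> 'M[C]_n.+1) : (0 < n)%N -> (p <= n)%N ->
  exists phi : {scalar 'M[C]_n.+1},
    (forall j, complex.Re (phi (X j)) \is a Num.int) /\
    exists2 Y, log_direction Y & complex.Re (phi Y) != 0.
Proof.
move=> n0 pn; have [W [Wu WY]] := spanning_basis log_direction_span.
pose E := \matrix_(j < p, a < n) complex.Re (((vec (X j))^T *m invmx W) 0 a).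
have [c [c0 Ec]] := integer_combination E n0 pn.
(* The complex functional whose value on the [a]-th basis vector is [c a 0]; since these values are
   real, its real part only sees the real parts of the coordinates. *)
pose d : 'cV[C]_n := invmx W *m map_mx (fun x : R => x%:C) c.
have phiE Y : mxform (row_mx (0 : 'M[C]_1) d^T) u Y = ((vec Y)^T *m d) 0 0.
  rewrite /mxform -mulmxA -[Y *m u](@vsubmxK _ 1 n 1) (@mul_row_col _ 1 1 n 1).
  by rewrite mul0mx add0r -[in LHS](trmxK (dsubmx _)) -trmx_mul mxE.
have Re_mul (z : C) (x : R) : complex.Re (z * x%:C) = complex.Re z * x.
  by case: z => a b; rewrite /= mulr0 subr0.
have ReE Y : complex.Re (mxform (row_mx (0 : 'M[C]_1) d^T) u Y) =
    \sum_a complex.Re (((vec Y)^T *m invmx W) 0 a) * c a 0.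
  rewrite phiE /d mulmxA mxE raddf_sum; apply: eq_bigr => a _.
  by rewrite [map_mx _ _ _ _]mxE /= Re_mul.
exists (mxform (row_mx (0 : 'M[C]_1) d^T) u); split=> [j|].
  rewrite ReE; suff -> : \sum_a complex.Re (((vec (X j))^T *m invmx W) 0 a) * c a 0 =
    (E *m c) j 0 by exact: Ec.
  by rewrite mxE; apply: eq_bigr => a _; rewrite [E _ _]mxE.
have [a ca] : exists a, c a 0 != 0.
  apply/existsP; apply: contraR c0 => /existsPn H.
  apply/eqP/colP => a; rewrite mxE.
  by have := H a; rewrite negbK => /eqP.
have [Y dY rowY] := WY a; exists Y => //.
rewrite ReE -rowY rowE -mulmxA mulmxV // mulmx1 (bigD1 a) //= big1 => [|b ba].
  by rewrite mxE !eqxx mul1r addr0.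
by rewrite mxE (negPf ba) andbF mul0r.
Qed.

(** Each log direction is the velocity of a one-parameter family of admissible units, along which
    the integral quantity is a polynomial vanishing at 0, hence identically zero. *)
Lemma log_direction_vanish (phi : {scalar 'M[C]_n.+1}) : (0 < n)%N ->
  (forall X, S X -> lam k0 X = 1 -> (forall k, lam k X != 0) ->
     complex.Re (phi (algebra_log e lam (@ln_normc R) X)) \is a Num.int) ->
  forall Y, log_direction Y -> complex.Re (phi Y) = 0.
Proof.
move=> n0 Hint Y [SY dirY].
have ReZ (x : R) (z : C) : complex.Re (x%:C * z) = x * complex.Re z.
  by case: z => a b; rewrite /= mul0r subr0.
have n0' : (1 < n.+1)%N by [].
case: dirY => [Y0|[j jk0 ->]].
- pose q : {poly R} :=
    \sum_(k < n.+1) complex.Re (log_coef C k * phi (Y ^+ k)) *: 'X^k.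
  have qE t : q.[t] = complex.Re (phi (algebra_log e lam (@ln_normc R) (1 + t%:C *: Y))).
    rewrite (algebra_log_unipotent S_alg e_lam (@ln_normcM R)) //.
    rewrite linear_sum raddf_sum horner_sum; apply: eq_bigr => k _.
    rewrite hornerZ hornerXn linearZ /= -rmorphXn -mulrA mulrCA ReZ.
    exact: mulrC.
  have SX t : S (1 + t *: Y) by apply: SD => //; exact: SZ.
  have lX k t : lam k (1 + t *: Y) = 1.
    by rewrite linearD linearZ /= Y0 mulr0 addr0 (lam1 S_alg e_lam).
  have q0 : q = 0.
    apply: integer_valued_poly => [t|].
      by rewrite qE; apply: Hint => // k; rewrite lX oner_eq0.
    rewrite horner_sum big_ord_recl big1 => [|k _].
      by rewrite log_coef0 mul0r scale0r horner0 addr0.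
    by rewrite hornerZ hornerXn expr0n mulr0.
  (* The degree-one term belongs to the truncated series because [n] is positive, and
     [log_coef C 1 = 1]. *)
  have := congr1 (fun p : {poly R} => p`_1) q0; rewrite coef0 coef_sum => <-.
  rewrite (bigD1 (Ordinal n0' : 'I_n.+1)) //= big1 => [|k k1].
    by rewrite coefZ coefXn eqxx mulr1 addr0 log_coef1 mul1r expr1.
  by rewrite coefZ coefXn eq_sym (negPf (k1 : (val k != 1)%N)) mulr0.
(* The family scales block [j] by [expR t]; since [j != k0], the character [lam k0] stays equal to
   1. *)
- have SX s : S (1 + (s - 1) *: e j).
    by apply: SD => //; apply: SZ; exact: (splitting_in e_lam).
  have q0 : complex.Re (phi (e j)) *: 'X = 0 :> {poly R}.
    apply: integer_valued_poly => [t|]; last by rewrite hornerZ hornerX mulr0.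
    have t0 : (expR t)%:C != 0 :> C by rewrite fmorph_eq0 gt_eqF // expR_gt0.
    have := Hint _ (SX (expR t)%:C).
    rewrite (algebra_log_scale_idempotent S_alg e_lam (@ln_normcM R)) //.
    rewrite ln_normc_exp linearZ /= ReZ hornerZ hornerX mulrC; apply.
      by rewrite (lam_scale_idempotent S_alg e_lam) eq_sym (negPf jk0).
    move=> k; rewrite (lam_scale_idempotent S_alg e_lam).
    by case: ifP => _ //; exact: oner_neq0.
  by have := congr1 (fun p : {poly R} => p`_1) q0; rewrite coefZ coefX mulr1 coef0.
Qed.

End Functional.

(** * Consequences of density, and passage from the generators to the group *)

Section Density.

(** Around a non-integer [h x] the open interval between consecutive integers pulls back to a
    neighbourhood of [x], which would meet [D]. *)
Lemma dense_integer_valued (R : realType) (T : topologicalType) (D : set T) (h : T -> R) x :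
  dense D -> (forall y, D y -> h y \is a Num.int) -> {for x, continuous h} ->
  h x \is a Num.int.
Proof.
move=> Dd hD cx; apply: contrapT => /negP hx.
pose I := [set y : R | (Num.floor (h x))%:~R < y < (Num.floor (h x) + 1)%:~R].
have Ix : nbhs (h x) I.
  apply: open_nbhs_nbhs; split; last first.
    rewrite /I /= floorD1_gt andbT lt_neqAle floor_le_tmp andbT.
    by apply: contraNneq hx => <-; rewrite intr_int.
  rewrite (_ : I = `]((Num.floor (h x))%:~R : R), ((Num.floor (h x) + 1)%:~R : R)[%classic).
    exact: interval_open.
  by apply/seteqP; split => y; rewrite /I /= in_itv.
have /nbhs_interior hI : nbhs x (h @^-1` I) by exact: cx.
have [|y [/interior_subset Iy Dy]] := Dd _ _ (@open_interior _ (h @^-1` I)).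
  by exists x; exact: nbhs_singleton hI.
have /intrP[k hk] := hD _ Dy; move: Iy.
by rewrite /I /= hk !ltr_int ltzD1 => /andP[/lt_le_trans kx /kx]; rewrite ltxx.
Qed.

Variables (K : numFieldType) (n : nat).

Definition affine_form (s : 'I_n.+1 -> K) (w : 'cV[K]_n) :=
  \sum_a (col_mx (1%:M : 'M[K]_1) w : 'cV[K]_n.+1) a 0 * s a.

Lemma affine_formE s w : affine_form s w = s 0 + \sum_a w a 0 * s (lift 0 a).
Proof.
rewrite /affine_form big_ord_recl; congr (_ + _).
  rewrite -[RHS]mul1r; congr (_ * _).
  have -> : ord0 = lshift n (0 : 'I_1) by exact: val_inj.
  by rewrite (@col_mxEu _ 1 n 1) mxE eqxx.
apply: eq_bigr => a _; have -> : lift 0 a = rshift 1 a by exact: val_inj.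
by rewrite (@col_mxEd _ 1 n 1).
Qed.

Lemma affine_form_continuous s : continuous (affine_form s).
Proof.
move=> w.
rewrite (_ : affine_form s = fun w : 'cV[K]_n => s 0 + \sum_a w a 0 * s (lift 0 a)).
  apply: continuousD; first exact: cst_continuous.
  apply: sum_continuous => a; apply: continuousM; last exact: cst_continuous.
  exact: coord_continuous.
by apply/funext => x; rewrite affine_formE.
Qed.

(** The nonvanishing set of the affine form is open; it is nonempty because a form vanishing at 0
    and at the unit vectors has zero coefficients. *)
Lemma dense_affine_form_neq0 (D : set 'cV[K]_n) (c : 'cV[K]_n.+1) : dense D -> c != 0 ->
  exists2 w, D w & (col_mx (1%:M : 'M[K]_1) w : 'cV[K]_n.+1)^T *m c != 0.
Proof.
move=> Dd c0.
pose f := affine_form (fun a => c a 0).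
have fE w : (col_mx (1%:M : 'M[K]_1) w : 'cV[K]_n.+1)^T *m c = (f w)%:M.
  apply/matrixP => a b; rewrite !ord1 !mxE eqxx mulr1n.
  by apply: eq_bigr => k _; rewrite mxE.
suff [w [fw Dw]] : (f @^-1` [set~ 0]) `&` D !=set0.
  exists w => //; apply/eqP; rewrite fE => /matrixP/(_ 0 0).
  by rewrite !mxE eqxx mulr1n.
apply: Dd; last first.
  apply: open_comp; first by move=> w _; exact: affine_form_continuous.
  apply: closed_openC; apply: accessible_closed_set1.
  by apply: hausdorff_accessible; exact: norm_hausdorff.
apply: contrapT => f0; move/eqP: c0; apply.
have {}f0 w : f w = 0 by apply: contrapT => fw; apply: f0; exists w.
have c00 : c 0 0 = 0.
  have := f0 0; rewrite /f affine_formE big1 ?addr0 // => a _.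
  by rewrite mxE mul0r.
apply/colP => a; rewrite mxE; case: (unliftP 0 a) => [b ->|-> //].
have := f0 (delta_mx b 0); rewrite /f affine_formE c00 add0r (bigD1 b) //= big1 => [|k kb].
  by rewrite mxE !eqxx mul1r addr0.
by rewrite mxE (negPf kb) mul0r.
Qed.

End Density.

(** The elements of [G] with integral [h] form a subgroup containing the generators, so minimality
    of the generated subgroup applies. *)
Lemma generated_integer (R : realType) (n p : nat)
    (G : set ('cV[R[i]]_n -> 'cV[R[i]]_n)) (s : 'I_p -> 'cV[R[i]]_n -> 'cV[R[i]]_n)
    (h : ('cV[R[i]]_n -> 'cV[R[i]]_n) -> R) :
  subgroup_GA G -> G = gen_subgroup_GA (range s) ->
  (forall j, h (s j) \is a Num.int) ->
  (forall f g, G f -> G g -> h (f \o g) = h f + h g) ->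
  forall f, G f -> h f \is a Num.int.
Proof.
move=> [GGA Gid Gcomp Ginv] Ggen hs hD.
have h1 : h id = 0 by apply: (addrI (h id)); rewrite -hD // addr0.
suff GG : G `<=` [set f | G f /\ h f \is a Num.int] by move=> f /GG[].
rewrite {1}Ggen; apply: smallest_sub; last first.
  move=> _ [j _ <-]; split; last exact: hs.
  by rewrite Ggen; apply: sub_gen_smallest; exists j.
split => [f [/GGA //]||f g [Gf hf] [Gg hg]|f [Gf hf]].
- by split => //; rewrite h1 rpred0.
- by split; [exact: Gcomp | rewrite hD // rpredD].
- have [g [Gg fg gf]] := Ginv f Gf; exists g; split => //; split => //.
  have : h f + h g = 0.
    by rewrite -hD // -h1; congr h; apply/funext => x; exact: gf.
  by move/eqP; rewrite addrC addr_eq0 => /eqP ->; rewrite rpredN.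
Qed.

(** * Contradiction from a dense orbit *)

Theorem corollary1p4 (R : realType) (n p : nat)
    (G : set ('cV[R[i]]_n -> 'cV[R[i]]_n)) :
  (1 <= n)%N -> (p <= n)%N ->
  subgroup_GA G -> abelian_maps G -> generated_by p G ->
  ~ exists v : 'cV[R[i]]_n, dense (map_orbit G v).
Proof.
move=> n0 pn G_group Gab [s [sGA Ggen]] [v vd].
have [GGA Gid Gcomp Ginv] := G_group.
pose H (X : 'M[R[i]]_n.+1) := exists2 f, G f & X = affine_mx f.
have mxM f h : G f -> G h -> affine_mx (f \o h) = affine_mx f * affine_mx h.
  by move=> Gf Gh; apply: affine_mxM; exact: GGA.
have HH X Y : H X -> H Y -> X * Y = Y * X.
  by move=> [f Gf ->] [h Gh ->]; rewrite -!mxM // Gab.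
pose u := affine_vec v.
(* A dense orbit lies in no affine hyperplane, so some [n.+1] homogenized orbit points form a basis;
   this makes [u] cyclic. *)
have [W [Wu WQ]] : exists W : 'M[R[i]]_n.+1, W \in unitmx /\
    forall j, exists2 f, G f & row j W = (affine_mx f *m u)^T.
  apply: (@spanning_basis _ _ (fun w => exists2 f, G f & w = (affine_mx f *m u)^T)).
  move=> c c0; have [_ [f Gf <-] fc] := dense_affine_form_neq0 vd c0.
  exists (affine_vec (f v))^T; split => //; exists f => //.
  by rewrite affine_mx_vec //; exact: GGA.
have WQ' j : exists f, G f /\ row j W = (affine_mx f *m u)^T.
  by have [f Gf jW] := WQ j; exists f.
have [F GF] := boolp.choice WQ'.
pose B j := affine_mx (F j).
have HB j : H (B j) by exists (F j); case: (GF j).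
have WB j : row j W = (B j *m u)^T by case: (GF j).
pose S := commutant H.
have S_alg : comm_subalgebra S := commutant_subalgebra HH HB WB Wu.
have HS X : H X -> S X := commutant_gen HH (X := X).
have SB j : S (B j) by exact: HS.
have [r [e [lam e_lam]]] := idempotent_decomposition (commutant_span HH HB WB Wu) SB S_alg.
have H0 X : H X -> delta_mx 0 0 *m X = (delta_mx 0 0 : 'rV_n.+1).
  by move=> [f _ ->]; exact: affine_mx_row0.
(* The block [k0] is the one carrying the affine character. *)
have [k0 chi_lam] := character_lam S_alg e_lam (chi1 _ _) (chiM HH HB WB Wu H0).
have u00 : u 0 0 = 1.
  have -> : (0 : 'I_n.+1) = lshift n (0 : 'I_1) by exact: val_inj.
  by rewrite /u /affine_vec (@col_mxEu _ 1 n 1) mxE eqxx.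
have u_lam X : S X -> (X *m u) 0 0 = lam k0 X.
  by move=> SX; rewrite (chi_vec HH HB WB Wu H0 SX) u00 mulr1 chi_lam.
have u_surj x : exists2 X, S X & X *m u = x.
  by exists (combo B W x); [exact: commutant_combo | exact: combo_vec].
pose L := algebra_log e lam (@ln_normc R).
have [phi [phi_int [Y dY phiY]]] :=
  integer_functional S_alg e_lam u_surj u_lam (fun j => L (affine_mx (s j))) n0 pn.
(* What remains is integrality of the real part of [phi] on the logarithms of all units with
   [lam k0] equal to 1. *)
move/eqP: phiY; apply; apply: (log_direction_vanish S_alg e_lam (k0 := k0)) dY => //.
have mx1 : affine_mx id = 1 :> 'M[R[i]]_n.+1.
  have -> : id = affine_map (1%:M) (0 : 'cV[R[i]]_n).
    by apply/funext => x; rewrite /affine_map mul1mx addr0.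
  by rewrite affine_mxE -scalar_mx_block.
have SG f : G f -> S (affine_mx f) by move=> Gf; apply: HS; exists f.
have lamG f k : G f -> lam k (affine_mx f) != 0.
  move=> Gf; have [h [Gh fh hf]] := Ginv f Gf; apply/eqP => lf0.
  have : lam k (affine_mx (f \o h)) = 1.
    have -> : f \o h = id by apply/funext => x; exact: hf.
    by rewrite mx1 (lam1 S_alg e_lam).
  rewrite mxM // (splitting_charM e_lam) ?lf0 ?mul0r; try exact: SG.
  by move/eqP; rewrite eq_sym oner_eq0.
have LM f h : G f -> G h -> L (affine_mx (f \o h)) = L (affine_mx f) + L (affine_mx h).
  move=> Gf Gh; rewrite mxM //.
  apply: (algebra_logM S_alg e_lam (@ln_normcM R)) => [||k|k]; try exact: SG.
    exact: lamG.
  exact: lamG.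
have G_int f : G f -> complex.Re (phi (L (affine_mx f))) \is a Num.int.
  apply: (generated_integer (h := fun f => complex.Re (phi (L (affine_mx f))))
    G_group Ggen phi_int).
  by move=> f1 f2 G1 G2; rewrite (LM f1 f2 G1 G2) linearD raddfD.
move=> X SX X1 X0.
(* Because [lam k0 X = 1], the first coordinate of [X *m u] is 1, so [X *m u] homogenizes a point
   [w]. *)
pose w : 'cV[R[i]]_n := @dsubmx _ 1 n 1 (X *m u).
have Xw : X *m u = affine_vec w.
  rewrite /affine_vec -[LHS](@vsubmxK _ 1 n 1); congr (@col_mx _ 1 n 1 _ _).
  apply/matrixP => a b; rewrite !ord1 !mxE eqxx.
  rewrite -X1 -u_lam // mxE; apply: eq_bigr => j _; congr (X _ j * _).
  exact: val_inj.
(* This map sends the orbit point [h v] to [affine_mx h] and is affine in [x], so integrality on the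
   group passes to [X = f w] by density and continuity at [w]. *)
pose f (x : 'cV[R[i]]_n) := combo B W (affine_vec x).
have Xf : X = f w by rewrite /f -Xw (comboK HH HB WB Wu SX).
rewrite Xf; apply: (dense_integer_valued (h := fun x => complex.Re (phi (L (f x)))) vd).
  move=> _ [h Gh <-]; rewrite /f -affine_mx_vec; last exact: GGA.
  by rewrite (comboK HH HB WB Wu (SG h Gh)); exact: G_int.
apply: (@continuous_comp _ _ _ (fun x => phi (L (f x))) (@complex.Re R));
  last exact: Re_continuous.
apply: entries_form; apply: entries_algebra_log; last exact: ln_normc_continuous.
  apply: entries_sum => j; apply: entriesZ; last exact: entries_cst.
  rewrite (_ : (fun _ => _) = affine_form (fun a => invmx W a j)).
    exact: affine_form_continuous.
  by apply/funext => x; rewrite mxE; apply: eq_bigr => a _; rewrite mxE.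
by move=> k; rewrite -Xf.
Qed.
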